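(* Work in the axiomatic setting described in the context. Let $\mathcal Z$ be a zigzag of homomorphisms with nodes $X_0,X_1,\dots,X_n$. Then $\mathcal Z$ induces a homomorphism $X_0\to X_n$ if and only if both of the following hold: (a) chasing the trivial subgroup of the initial node $X_0$ forward along $\mathcal Z$ results in the trivial subgroup of the final node $X_n$; (b) chasing the largest subgroup of the final node $X_n$ backward along $\mathcal Z$ results in the largest subgroup of the initial node $X_0$. Moreover, when $\mathcal Z$ induces a homomorphism, the induced homomorphism is unique (it does not depend on the pyramid constructed from $\mathcal Z$), and the direct and inverse image maps of the induced homomorphism are given by chasing a subgroup forward and backward, respectively, along $\mathcal Z$.
   Context: **Axiomatic setting.** The words ''group'', ''homomorphism'', ''subgroup'' are primitive notions (ordinary groups are only one model). The data are: groups; homomorphisms $f\colon X\to Y$ between groups, with a composition; for each group $G$ a collection $\mathrm{Sub}\,G$ of subgroups of $G$ with a relation $\subseteq$; and for each homomorphism $f\colon X\to Y$ a direct image map $A\mapsto fA$, $\mathrm{Sub}\,X\to \mathrm{Sub}\,Y$, and an inverse image map $B\mapsto f^{-1}B$, $\mathrm{Sub}\,Y\to\mathrm{Sub}\,X$. The following axioms are assumed. Axiom 1. Groups and homomorphisms form a category (with identities $1_G$); each $(\mathrm{Sub}\,G,\subseteq)$ is a poset; $fA\subseteq B\Leftrightarrow A\subseteq f^{-1}B$ for all $f\colon X\to Y$, $A\in\mathrm{Sub}\,X$, $B\in\mathrm{Sub}\,Y$; the direct and inverse image maps of $1_G$ are identity maps, and $f(gA)=(fg)A$, $g^{-1}(f^{-1}B)=(fg)^{-1}B$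 for composable $f,g$. Axiom 2. Each $\mathrm{Sub}\,G$ is a bounded lattice, with meet $\wedge$, join $\vee$, smallest (trivial) element denoted $1$ and largest element denoted $G$. For $f\colon X\to Y$ put $\mathrm{Im} f=fX$ (direct image of the largest subgroup) and $\mathrm{Ker} f=f^{-1}1$ (inverse image of the trivial subgroup). Then $ff^{-1}B=B\wedge\mathrm{Im} f$ and $f^{-1}fA=A\vee\mathrm{Ker} f$ for all $A\in\mathrm{Sub}\,X$, $B\in\mathrm{Sub}\,Y$. A subgroup of $G$ is *normal* if it equals $\mathrm{Ker} f$ for some homomorphism $f\colon G\to H$, and *conormal* if it equals $\mathrm{Im} f$ for some homomorphism $f\colon F\to G$. An *embedding associated to* a subgroup $S$ of $G$ is a homomorphism $m\colon M\to G$ with $\mathrm{Im}\, m\subseteq S$ such that every $m'\colon M'\to G$ with $\mathrm{Im}\, m'\subseteq S$ factors as $m'=mu$ for a unique $u$. Dually, a *projection associated to* $S$ is a homomorphism $e\colon G\to E$ with $S\subseteq \mathrm{Ker}\, e$ such that every $e'\colon G\to E'$ with $S\subseteq\mathrm{Ker}\, e'$ factors as $e'=ve$ for a unique $v$. An embedding (projection) is one associated to some subgroup. Axiom 3. Each conormal subgroup $S$ of $G$ has an associated embedding $\iota_S\colon S/1\to G$, and each normal subgroup $S$ of $G$ has an associated projection $\pi_S\colon G\to G/S$ (fixed choices, with $\iota_G=1_G$ for the largest subgroup and $\pi_1=1_G$ for the trivial subgroup). Axiom 4. Every homomorphism $f\colon X\to Y$ factorizes as $f=\iota_{\mathrm{Im}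 f}\,h\,\pi_{\mathrm{Ker} f}$ with $h$ an isomorphism. Axiom 5. The join of two normal subgroups of a group is normal, and the meet of two conormal subgroups of a group is conormal. **Zigzags and chasing.** A zigzag with nodes $X_0,\dots,X_n$ ($n\ge 1$) consists of homomorphisms $f_1,\dots,f_n$, where each $f_i$ is either right-pointing, $f_i\colon X_{i-1}\to X_i$, or left-pointing, $f_i\colon X_i\to X_{i-1}$. Chasing a subgroup $S$ of $X_0$ forward along the zigzag yields the subgroup $f_n^*\cdots f_1^*S$ of $X_n$, where $f_i^*$ is the direct image map of $f_i$ if $f_i$ is right-pointing and the inverse image map of $f_i$ if $f_i$ is left-pointing. Chasing a subgroup of $X_n$ backward means chasing it along the reversed zigzag: one successively applies, for $i=n,\dots,1$, the inverse image map of $f_i$ if $f_i$ is right-pointing and the direct image map of $f_i$ if $f_i$ is left-pointing. A zigzag is *collapsible* if all its left-pointing arrows are isomorphisms; the homomorphism induced by a collapsible zigzag is the composite $X_0\to X_n$ of the right-pointing arrows and the inverses of the left-pointing ones. **Pyramid of a zigzag.** It has nodes $X^j_i$, $0\le i\le j\le n$, with $X^i_i=X_i$. For $i<j$ the node $X_i^j$ has lower-left neighbour $X_i^{j-1}$ and lower-right neighbour $X_{i+1}^j$; neighbours are joined by one homomorphism, pointing either upward (then it is a projection) or downward (then it is an embedding). It is built bottom-up. Base: for each $i$, factor $f_i=me$ with $e$ a projection associated to $\mathrm{Ker} f_i$ and $m$ an embedding associated to $\mathrm{Im} f_i$; $X^i_{i-1}$ is the codomain of $e$ (the domain of $m$),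 $e$ is the upward edge from the domain of $f_i$ and $m$ the downward edge to the codomain of $f_i$. Step: given the bottom wedge formed by the edges joining $X^i_j$ (with $1\le j\le i\le n-1$) to $X^i_{j-1}$ and to $X^{i+1}_j$, construct $X^{i+1}_{j-1}$ and its edges to $X^i_{j-1}$ and $X^{i+1}_j$ as follows. - If both edges of the wedge point upward, $a\colon X^i_j\to X^i_{j-1}$ and $b\colon X^i_j\to X^{i+1}_j$, let $p\colon X^i_j\to X^{i+1}_{j-1}$ be a projection associated to $\mathrm{Ker}\,a\vee\mathrm{Ker}\,b$; the new edges are the homomorphisms $x\colon X^i_{j-1}\to X^{i+1}_{j-1}$ and $y\colon X^{i+1}_j\to X^{i+1}_{j-1}$ with $xa=p=yb$. - If both point downward, do the dual: $q\colon X^{i+1}_{j-1}\to X^i_j$ is an embedding associated to the meet of the images of the two wedge edges, and the new (downward) edges are the factorizations of $q$ through the two wedge edges. - If one edge of the wedge points downward into $X^i_j$ and the other upward out of $X^i_j$, form their composite $c$ (between $X^i_{j-1}$ and $X^{i+1}_j$), factor $c=m_2e_2$ with $e_2$ a projection associated to $\mathrm{Ker}\,c$ and $m_2$ an embedding associated to $\mathrm{Im}\,c$; $X^{i+1}_{j-1}$ is the codomain of $e_2$, and $e_2$ (upward), $m_2$ (downward) are the new edges. The pyramid is unique up to isomorphisms between corresponding nodes commuting with all edges. The *principal horizontal zigzag* is the zigzag $X^0_0,X^1_0,\dots,X^n_0,X^n_1,\dots,X^n_n$ along the two sides of the pyramid, read from $X_0=X_0^0$ to $X_n=X^n_n$.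 A zigzag *induces a homomorphism* if the principal horizontal zigzag of a pyramid constructed from it is collapsible; the homomorphism $X_0\to X_n$ induced by that collapsible zigzag is then called the *induced homomorphism* of the original zigzag. *)

(* Defs.v *)
From mathcomp Require Import all_boot.

Set Implicit Arguments.
Unset Strict Implicit.
Unset Printing Implicit Defensive.

Declare Scope nf_scope.
Delimit Scope nf_scope with NF.
Local Open Scope nf_scope.

(* Subgroups are compared by a Prop-valued order with Leibniz equality, so that
   no decidability or choice structure is imposed on them. *)
Record form_data := FormData {
  Grp : Type;
  Hom : Grp -> Grp -> Type;
  idh : forall G, Hom G G;
  hcomp : forall X Y Z, Hom Y Z -> Hom X Y -> Hom X Z;
  Subgrp : Grp -> Type;
  sle : forall G, Subgrp G -> Subgrp G -> Prop;
  dimg : forall X Y, Hom X Y -> Subgrp X -> Subgrp Y;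
  pimg : forall X Y, Hom X Y -> Subgrp Y -> Subgrp X;
  smeet : forall G, Subgrp G -> Subgrp G -> Subgrp G;
  sjoin : forall G, Subgrp G -> Subgrp G -> Subgrp G;
  sbot : forall G, Subgrp G;
  stop : forall G, Subgrp G
}.

Arguments idh {f} G.
Arguments hcomp {f X Y Z} _ _.
Arguments sle {f G} _ _.
Arguments dimg {f X Y} _ _.
Arguments pimg {f X Y} _ _.
Arguments smeet {f G} _ _.
Arguments sjoin {f G} _ _.
Arguments sbot {f} G.
Arguments stop {f} G.

Notation "f \o g" := (hcomp f g) : nf_scope.

Section Notions.
Variable F : form_data.
Implicit Types G X Y : Grp F.

Definition Im X Y (f : Hom X Y) : Subgrp Y := dimg f (stop X).
Definition Ker X Y (f : Hom X Y) : Subgrp X := pimg f (sbot Y).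

Definition normal G (S : Subgrp G) : Prop :=
  exists (H : Grp F) (f : Hom G H), S = Ker f.
Definition conormal G (S : Subgrp G) : Prop :=
  exists (E : Grp F) (f : Hom E G), S = Im f.

Lemma normal_Ker X Y (f : Hom X Y) : normal (Ker f).
Proof. by exists Y, f. Qed.
Lemma conormal_Im X Y (f : Hom X Y) : conormal (Im f).
Proof. by exists X, f. Qed.

Definition embedding_of G (S : Subgrp G) M (m : Hom M G) : Prop :=
  sle (Im m) S /\
  forall M' (m' : Hom M' G), sle (Im m') S ->
    exists! u : Hom M' M, m' = m \o u.

Definition projection_of G (S : Subgrp G) E (e : Hom G E) : Prop :=
  sle S (Ker e) /\
  forall E' (e' : Hom G E'), sle S (Ker e') ->
    exists! v : Hom E E', e' = v \o e.

Definition inverse X Y (f : Hom X Y) (g : Hom Y X) : Prop :=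
  g \o f = idh X /\ f \o g = idh Y.
Definition iso X Y (f : Hom X Y) : Prop := exists g, inverse f g.

End Notions.

Arguments Im {F X Y} f.
Arguments Ker {F X Y} f.

Record noetherian_form := NoetherianForm {
  nf_data :> form_data;

  compA : forall (W X Y Z : Grp nf_data)
    (f : Hom Y Z) (g : Hom X Y) (h : Hom W X), f \o (g \o h) = (f \o g) \o h;
  comp1h : forall (X Y : Grp nf_data) (f : Hom X Y), idh Y \o f = f;
  comph1 : forall (X Y : Grp nf_data) (f : Hom X Y), f \o idh X = f;
  sle_refl : forall (G : Grp nf_data) (A : Subgrp G), sle A A;
  sle_trans : forall (G : Grp nf_data) (A B C : Subgrp G),
    sle A B -> sle B C -> sle A C;
  sle_anti : forall (G : Grp nf_data) (A B : Subgrp G),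
    sle A B -> sle B A -> A = B;
  dimg_pimg : forall (X Y : Grp nf_data) (f : Hom X Y)
    (A : Subgrp X) (B : Subgrp Y),
    sle (dimg f A) B <-> sle A (pimg f B);
  dimg_id : forall (G : Grp nf_data) (A : Subgrp G), dimg (idh G) A = A;
  pimg_id : forall (G : Grp nf_data) (A : Subgrp G), pimg (idh G) A = A;
  dimg_comp : forall (X Y Z : Grp nf_data) (f : Hom Y Z) (g : Hom X Y)
    (A : Subgrp X), dimg f (dimg g A) = dimg (f \o g) A;
  pimg_comp : forall (X Y Z : Grp nf_data) (f : Hom Y Z) (g : Hom X Y)
    (B : Subgrp Z), pimg g (pimg f B) = pimg (f \o g) B;

  smeet_glb : forall (G : Grp nf_data) (A B C : Subgrp G),
    sle C (smeet A B) <-> sle C A /\ sle C B;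
  sjoin_lub : forall (G : Grp nf_data) (A B C : Subgrp G),
    sle (sjoin A B) C <-> sle A C /\ sle B C;
  sbot_le : forall (G : Grp nf_data) (A : Subgrp G), sle (sbot G) A;
  sle_top : forall (G : Grp nf_data) (A : Subgrp G), sle A (stop G);
  dimgK : forall (X Y : Grp nf_data) (f : Hom X Y) (B : Subgrp Y),
    dimg f (pimg f B) = smeet B (Im f);
  pimgK : forall (X Y : Grp nf_data) (f : Hom X Y) (A : Subgrp X),
    pimg f (dimg f A) = sjoin A (Ker f);

  (* The equations iota_top and pi_bot also assert that the chosen
     domain, resp. codomain, is G itself, hence the dependent pairs *)
  sdom : forall (G : Grp nf_data) (S : Subgrp G), conormal S -> Grp nf_data;
  iota : forall (G : Grp nf_data) (S : Subgrp G) (cS : conormal S),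
    Hom (sdom cS) G;
  iotaP : forall (G : Grp nf_data) (S : Subgrp G) (cS : conormal S),
    embedding_of S (iota cS);
  iota_top : forall (G : Grp nf_data) (cG : conormal (stop G)),
    existT (fun M => Hom M G) (sdom cG) (iota cG)
    = existT (fun M => Hom M G) G (idh G);
  quo : forall (G : Grp nf_data) (S : Subgrp G), normal S -> Grp nf_data;
  pi : forall (G : Grp nf_data) (S : Subgrp G) (nS : normal S), Hom G (quo nS);
  piP : forall (G : Grp nf_data) (S : Subgrp G) (nS : normal S),
    projection_of S (pi nS);
  pi_bot : forall (G : Grp nf_data) (nG : normal (sbot G)),
    existT (fun E => Hom G E) (quo nG) (pi nG)
    = existT (fun E => Hom G E) G (idh G);

  iso_factor : forall (X Y : Grp nf_data) (f : Hom X Y),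
    exists h : Hom (quo (normal_Ker f)) (sdom (conormal_Im f)),
      iso h /\ f = iota (conormal_Im f) \o (h \o pi (normal_Ker f));

  normal_join : forall (G : Grp nf_data) (A B : Subgrp G),
    normal A -> normal B -> normal (sjoin A B);
  conormal_meet : forall (G : Grp nf_data) (A B : Subgrp G),
    conormal A -> conormal B -> conormal (smeet A B)
}.

Section Zigzags.
Variable F : form_data.

Inductive arrow (X Y : Grp F) : Type :=
| Rarr of Hom X Y
| Larr of Hom Y X.

Inductive zigzag (X : Grp F) : Grp F -> Type :=
| zz_nil : zigzag X X
| zz_snoc Y Z : zigzag X Y -> arrow Y Z -> zigzag X Z.

Definition fwd X Y (a : arrow X Y) : Subgrp X -> Subgrp Y :=
  match a with Rarr f => dimg f | Larr f => pimg f end.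
Definition bwd X Y (a : arrow X Y) : Subgrp Y -> Subgrp X :=
  match a with Rarr f => pimg f | Larr f => dimg f end.

Fixpoint chase X Y (z : zigzag X Y) : Subgrp X -> Subgrp Y :=
  match z with
  | zz_nil => fun S => S
  | zz_snoc _ _ z' a => fun S => fwd a (chase z' S)
  end.
Fixpoint chase_back X Y (z : zigzag X Y) : Subgrp Y -> Subgrp X :=
  match z with
  | zz_nil => fun S => S
  | zz_snoc _ _ z' a => fun S => chase_back z' (bwd a S)
  end.

Fixpoint collapsible X Y (z : zigzag X Y) : Prop :=
  match z with
  | zz_nil => True
  | zz_snoc _ _ z' a =>
      collapsible z' /\ match a with Rarr _ => True | Larr f => iso f end
  end.

(* h is the composite of the right-pointing arrows and of the inverses of the
   left-pointing ones; for a collapsible z there is exactly one such h *)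
Fixpoint composite X Y (z : zigzag X Y) : Hom X Y -> Prop :=
  match z with
  | zz_nil => fun h => h = idh _
  | zz_snoc _ _ z' a => fun h =>
      exists2 k, composite z' k &
      match a with
      | Rarr f => h = f \o k
      | Larr f => exists2 g, inverse f g & h = g \o k
      end
  end.

(* The zigzag X 0, ..., X n; the values of X beyond n play no role. *)
Section OfArrows.
Variables (n : nat) (X : nat -> Grp F).
Variable f : forall i, i < n -> arrow (X i) (X i.+1).

Fixpoint prefix k : k <= n -> zigzag (X 0) (X k) :=
  match k with
  | 0 => fun _ => zz_nil (X 0)
  | k'.+1 => fun lt_k'n => zz_snoc (prefix (ltnW lt_k'n)) (f lt_k'n)
  end.

Definition zigzag_of : zigzag (X 0) (X n) := prefix (leqnn n).
End OfArrows.

(* Edges of a pyramid are read from left to right. For an edge that climbs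
   (lower node, then upper node), Rarr is upward and Larr downward; for an edge
   that descends, Rarr is downward and Larr upward. *)

Definition factor_roof A B U (f : arrow A B) (l : arrow A U) (r : arrow U B)
  : Prop :=
  match f with
  | Rarr f => exists (e : Hom A U) (m : Hom U B),
      [/\ projection_of (Ker f) e, embedding_of (Im f) m, f = m \o e,
          l = Rarr e & r = Rarr m]
  | Larr f => exists (e : Hom B U) (m : Hom U A),
      [/\ projection_of (Ker f) e, embedding_of (Im f) m, f = m \o e,
          l = Larr m & r = Larr e]
  end.

(*        T
       l' / \ r'
         L   R       (B, l, r) is the bottom wedge, (T, l', r') the new part
       l \ / r
          B                                                                *)
Definition wedge_roof L B R T (l : arrow L B) (r : arrow B R)
    (l' : arrow L T) (r' : arrow T R) : Prop :=
  match l, r with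
  | Larr a, Rarr b =>
      exists (p : Hom B T) (x : Hom L T) (y : Hom R T),
      [/\ projection_of (sjoin (Ker a) (Ker b)) p, x \o a = p, y \o b = p,
          l' = Rarr x & r' = Larr y]
  | Rarr a, Larr b =>
      exists (q : Hom T B) (x : Hom T L) (y : Hom T R),
      [/\ embedding_of (smeet (Im a) (Im b)) q, a \o x = q, b \o y = q,
          l' = Larr x & r' = Rarr y]
  | Rarr a, Rarr b => factor_roof (Rarr (b \o a)) l' r'
  | Larr a, Larr b => factor_roof (Larr (a \o b)) l' r'
  end.

Section Pyramids.
Variables (n : nat) (X : nat -> Grp F).

(* pnode up i d stands for the node X_i^(i+d), at height d over the base; it
   lies in the pyramid when i + d <= n. Its lower neighbours are
   X_i^(i+d-1) = pnode up i d.-1 and X_(i+1)^(i+d) = pnode up i.+1 d.-1. *)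
Definition pnode (up : nat -> nat -> Grp F) (i d : nat) : Grp F :=
  if d is d'.+1 then up i d' else X i.

Record pyramid (f : forall i, i < n -> arrow (X i) (X i.+1)) := Pyramid {
  up : nat -> nat -> Grp F;
  climb : forall i d, i + d < n -> arrow (pnode up i d) (pnode up i d.+1);
  descend : forall i d, i + d < n -> arrow (pnode up i d.+1) (pnode up i.+1 d);
  pyramid_base : forall i (h : i < n) (h0 : i + 0 < n),
    factor_roof (@f i h) (climb h0) (descend h0);
  pyramid_step : forall i d
    (h1 : i + d < n) (h2 : i.+1 + d < n) (h : i + d.+1 < n),
    wedge_roof (descend h1) (climb h2) (climb h) (descend h)
}.

Variables (f : forall i, i < n -> arrow (X i) (X i.+1)) (P : pyramid f).

Fixpoint left_side d : d <= n -> zigzag (X 0) (pnode (up P) 0 d) :=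
  match d with
  | 0 => fun _ => zz_nil (X 0)
  | d'.+1 => fun h => zz_snoc (left_side (ltnW h)) (climb P (h : 0 + d' < n))
  end.

Lemma side_top d : 0 + d = n -> d <= n.
Proof. by move=> <-; rewrite add0n. Qed.
Lemma side_prev i d : i.+1 + d = n -> i + d.+1 = n.
Proof. by rewrite addnS. Qed.
Lemma side_lt i d : i.+1 + d = n -> i + d < n.
Proof. by move=> <-; rewrite addSn. Qed.

(* the left side followed by the first i edges of the right side *)
Fixpoint sides i : forall d, i + d = n -> zigzag (X 0) (pnode (up P) i d) :=
  match i with
  | 0 => fun _ e => left_side (side_top e)
  | i'.+1 => fun _ e => zz_snoc (sides (side_prev e)) (descend P (side_lt e))
  end.

Definition principal : zigzag (X 0) (X n) := sides (addn0 n).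

Definition induced_by (h : Hom (X 0) (X n)) : Prop :=
  collapsible principal /\ composite principal h.

End Pyramids.

Definition induces n (X : nat -> Grp F)
    (f : forall i, i < n -> arrow (X i) (X i.+1)) : Prop :=
  exists P : pyramid f, collapsible (principal P).

End Zigzags.

(* Main.v *)
(** A homomorphism e with Im e = stop is epic, and is a projection associated to
    Ker e; dually for homomorphisms m with Ker m = sbot and embeddings. The climbing
    edges of a pyramid are thus surjections read rightwards or injections read
    leftwards, and the descending edges the other way round.

    Replacing a wedge by its roof changes neither forward nor backward chasing, so
    chasing along the base and along the two sides of the pyramid agree. Backward
    chasing is injective along the left side and preserves the largest subgroup along
    the right side; so if it sends the largest subgroup of X_n to that of X_0, every
    injection met on the left side has full image and is an isomorphism. The right
    side is handled dually with the trivial subgroup. Uniqueness follows from the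
    canonical isomorphism between any two pyramids that is the identity on the base. *)

From mathcomp Require Import all_boot.
From Stdlib Require Import ProofIrrelevance IndefiniteDescription.
Require Import Defs.

Set Implicit Arguments.
Unset Strict Implicit.
Unset Printing Implicit Defensive.

Local Open Scope nf_scope.

(** * Surjections and injections *)

Section Forms.
Variable F : noetherian_form.
Implicit Types G X Y Z : Grp F.

Lemma sle_eq G (A B : Subgrp G) : A = B -> sle A B.
Proof. by move=> ->; exact: sle_refl. Qed.

Lemma sbot_eq G (A : Subgrp G) : sle A (sbot G) -> A = sbot G.
Proof. by move=> le_A; apply: sle_anti le_A (sbot_le _). Qed.

Lemma stop_eq G (A : Subgrp G) : sle (stop G) A -> A = stop G.
Proof. by move=> le_A; apply: sle_anti (sle_top _) le_A. Qed.

Lemma smeet_top G (A : Subgrp G) : smeet A (stop G) = A.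
Proof.
apply: sle_anti.
  by case/smeet_glb: (sle_refl (smeet A (stop G))).
by apply/smeet_glb; split; [exact: sle_refl | exact: sle_top].
Qed.

Lemma sjoin_le G (A B : Subgrp G) : sle B A -> sjoin A B = A.
Proof.
move=> leBA; apply: sle_anti.
  by apply/sjoin_lub; split; [exact: sle_refl |].
by have /sjoin_lub[] := sle_refl (sjoin A B).
Qed.

Lemma sjoinC G (A B : Subgrp G) : sjoin A B = sjoin B A.
Proof.
have le_join C D : sle (sjoin C D) (sjoin D C :> Subgrp G).
  by have /sjoin_lub[leD leC] := sle_refl (sjoin D C); apply/sjoin_lub.
exact: sle_anti.
Qed.

Lemma dimg_le X Y (f : Hom X Y) (A B : Subgrp X) :
  sle A B -> sle (dimg f A) (dimg f B).
Proof.
move=> leAB; apply/dimg_pimg; apply: sle_trans leAB _.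
by apply/dimg_pimg; exact: sle_refl.
Qed.

Lemma dimg_bot X Y (f : Hom X Y) : dimg f (sbot X) = sbot Y.
Proof. by apply: sbot_eq; apply/dimg_pimg; exact: sbot_le. Qed.

Lemma dimg_surjK X Y (e : Hom X Y) (B : Subgrp Y) :
  Im e = stop Y -> dimg e (pimg e B) = B.
Proof. by move=> surj; rewrite dimgK surj smeet_top. Qed.

Lemma Im_comp X Y Z (g : Hom Y Z) (f : Hom X Y) : Im (g \o f) = dimg g (Im f).
Proof. by rewrite /Im dimg_comp. Qed.

Lemma Im_compl X Y Z (g : Hom Y Z) (f : Hom X Y) :
  Im (g \o f) = stop Z -> Im g = stop Z.
Proof.
rewrite Im_comp => surj; apply: stop_eq; rewrite -{1}surj.
by apply: dimg_le; exact: sle_top.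
Qed.

Lemma Im_surjr X Y Z (g : Hom Y Z) (f : Hom X Y) :
  Im f = stop Y -> Im (g \o f) = Im g.
Proof. by rewrite Im_comp => ->. Qed.

Lemma iso_surj X Y (f : Hom X Y) : iso f -> Im f = stop Y.
Proof.
case=> g [_ fg]; apply: (@Im_compl _ _ _ f g).
by rewrite fg /Im dimg_id.
Qed.

Lemma iso_comp X Y Z (g : Hom Y Z) (f : Hom X Y) : iso g -> iso f -> iso (g \o f).
Proof.
case=> g' [g'g gg'] [f' [f'f ff']]; exists (f' \o g'); split.
  by rewrite compA -(compA f') g'g comph1.
by rewrite compA -(compA g) ff' comph1.
Qed.

Lemma iso_iota G (S : Subgrp G) (cS : conormal S) : S = stop G -> iso (iota cS).
Proof.
move=> S_top; subst S; move: (iota_top cS).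
move: (sdom cS) (iota cS) => M m eqm.
(* Stated through [projT2], the goal can be rewritten with an equality of dependent pairs. *)
have: iso (projT2 (existT (fun M => Hom M G) M m)).
  by rewrite eqm /=; exists (idh G); split; exact: comp1h.
by [].
Qed.

(** In the factorization of [e] as [i \o (h \o p)], the part [h \o p] also kills [S], so it equals
    [v \o e]. Uniqueness of factorizations through [e] gives [i \o v = idh E]; hence [i] has full
    image, which lies in [Im e]. *)
Lemma projection_surj G S E (e : Hom G E) : projection_of S e -> Im e = stop E.
Proof.
case=> leS univ; have [h [_ def_e]] := iso_factor e.
set i := iota _ in def_e; set p := pi _ in def_e.
have [leKp _] : projection_of (Ker e) p by exact: piP.
have leSp : sle S (Ker (h \o p)).
  apply: sle_trans leS _; apply: sle_trans leKp _.
  rewrite /Ker -pimg_comp; apply/dimg_pimg.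
  have: sle (dimg p (pimg p (sbot _))) (sbot (quo (normal_Ker e))).
    by apply/dimg_pimg; exact: sle_refl.
  by move/sle_trans; apply; exact: sbot_le.
have [v [def_v _]] := univ _ _ leSp.
have [w [_ uniq_w]] := univ _ _ leS.
have iv1 : i \o v = idh E.
  rewrite -(uniq_w (i \o v)) ?(uniq_w (idh E)) ?comp1h //.
  by rewrite -compA -def_v.
have surj_i : Im i = stop E.
  by apply: (@Im_compl _ _ _ i v); rewrite iv1 /Im dimg_id.
apply: stop_eq; rewrite -surj_i.
by have [] : embedding_of (Im e) i by exact: iotaP.
Qed.

(** A homomorphism with kernel [S] factors through [e], which bounds [Ker e] by [S]. *)
Lemma projection_Ker G (S : Subgrp G) E (e : Hom G E) :
  normal S -> projection_of S e -> Ker e = S.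
Proof.
case=> H [f def_S] [leS univ]; apply: sle_anti => //.
have [|v [def_f _]] := univ _ f; first by rewrite def_S; exact: sle_refl.
rewrite {1}def_S def_f /Ker -pimg_comp; apply/dimg_pimg.
apply: (@sle_trans _ _ _ (sbot E)); last exact: sbot_le.
by apply/dimg_pimg; exact: sle_refl.
Qed.

Lemma projection_epi G (S : Subgrp G) E (e : Hom G E) Z (u v : Hom E Z) :
  projection_of S e -> u \o e = v \o e -> u = v.
Proof.
case=> leS univ eq_uv; have [|w [_ uniq_w]] := univ _ (u \o e).
  apply: sle_trans leS _; rewrite /Ker -pimg_comp; apply/dimg_pimg.
  apply: (@sle_trans _ _ _ (sbot E)); last exact: sbot_le.
  by apply/dimg_pimg; exact: sle_refl.
by rewrite -(uniq_w u) // -(uniq_w v).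
Qed.

(** A full image makes [iota] an isomorphism, so [e] is the chosen projection of its kernel followed
    by an isomorphism [k]. *)
Lemma surj_projection X Y (e : Hom X Y) :
  Im e = stop Y -> projection_of (Ker e) e.
Proof.
move=> surj; have [h [iso_h def_e]] := iso_factor e.
have iso_i : iso (iota (conormal_Im e)) by exact: iso_iota.
move: def_e; rewrite compA.
move: (iso_comp iso_i iso_h); move: (iota _ \o h) => k [k' [k'k kk']] def_e.
have proj_p := piP (normal_Ker e); have [_ univ] := proj_p.
have eq_p : pi (normal_Ker e) = k' \o e by rewrite -[LHS]comp1h -k'k -compA -def_e.
split=> [|E' e' /univ[v [def_v _]]]; first exact: sle_refl.
exists (v \o k'); split=> [|w def_w]; first by rewrite -compA -eq_p.
suff -> : v = w \o k by rewrite -compA kk' comph1.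
by apply: (projection_epi proj_p); rewrite -compA -def_e -def_v.
Qed.

Lemma surj_epi X Y Z (e : Hom X Y) (u v : Hom Y Z) :
  Im e = stop Y -> u \o e = v \o e -> u = v.
Proof. by move/surj_projection/projection_epi; apply. Qed.

Lemma surj_lift X Y Z (e : Hom X Y) (f : Hom X Z) :
  Im e = stop Y -> sle (Ker e) (Ker f) ->
  exists v : Hom Y Z, v \o e = f.
Proof. by move/surj_projection=> [_ univ] /univ[v [def_f _]]; exists v. Qed.

Lemma projection_normal_Ker G (A B : Subgrp G) E (e : Hom G E) :
  normal A -> normal B -> projection_of (sjoin A B) e -> Ker e = sjoin A B.
Proof. by move=> nA nB; apply: projection_Ker; exact: normal_join. Qed.

Lemma pushout_exists (B L R : Grp F) (a : Hom B L) (b : Hom B R) :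
  Im a = stop L -> Im b = stop R ->
  exists T (p : Hom B T) (x : Hom L T) (y : Hom R T),
    [/\ projection_of (sjoin (Ker a) (Ker b)) p, x \o a = p & y \o b = p].
Proof.
move=> surj_a surj_b.
have nab : normal (sjoin (Ker a) (Ker b)).
  by apply: normal_join; exact: normal_Ker.
have proj_p := piP nab; have [/sjoin_lub[lea leb] _] := proj_p.
have [x def_x] := surj_lift surj_a lea; have [y def_y] := surj_lift surj_b leb.
by exists (quo nab), (pi nab), x, y.
Qed.

(** As [S] is the image of [pimg a S] under the surjection [a], the right side is
    [pimg y (dimg y V)] with [V = dimg b (pimg a S)]. It remains to place [Ker y] below [V]:
    surjectivity of [b] makes [Ker y] the image under [b] of [Ker p], the join of [Ker a] and
    [Ker b]. *)
Lemma pushout_chase (B L R T : Grp F) (a : Hom B L) (b : Hom B R) (p : Hom B T)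
    (x : Hom L T) (y : Hom R T) (S : Subgrp L) :
  Im a = stop L -> Im b = stop R ->
  projection_of (sjoin (Ker a) (Ker b)) p -> x \o a = p -> y \o b = p ->
  dimg b (pimg a S) = pimg y (dimg x S).
Proof.
move=> surj_a surj_b proj_p xa yb.
have Kp := projection_normal_Ker (normal_Ker a) (normal_Ker b) proj_p.
rewrite -{2}(dimg_surjK S surj_a) dimg_comp xa -yb -dimg_comp pimgK sjoin_le //.
rewrite -(dimg_surjK (Ker y) surj_b) pimg_comp yb -[pimg p _]/(Ker p) Kp.
apply/dimg_pimg/sjoin_lub; split.
  apply: (@sle_trans _ _ _ (pimg a S)).
    by apply/dimg_pimg; rewrite dimg_surjK //; exact: sbot_le.
  by apply/dimg_pimg; exact: sle_refl.
by apply/dimg_pimg; rewrite dimg_surjK //; exact: sbot_le.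
Qed.

End Forms.

(* The axioms are invariant under reversing homomorphisms and inclusions, which
   exchanges direct with inverse images and projections with embeddings. *)
Definition dual_data (F : form_data) : form_data :=
  @FormData (Grp F) (fun X Y => Hom Y X) (@idh F)
    (fun X Y Z g f => f \o g) (@Subgrp F) (fun G A B => sle B A)
    (fun X Y f => pimg f) (fun X Y f => dimg f)
    (@sjoin F) (@smeet F) (@stop F) (@sbot F).

(* Proof irrelevance is needed because [iota] and [pi] depend on a proof of
   (co)normality, and duality exchanges [normal_Ker] with [conormal_Im]. *)
Lemma dual_factor (F : noetherian_form) (X Y : Grp F) (f : Hom Y X)
    (nK : normal (Ker f)) (cI : conormal (Im f)) :
  exists h : Hom (quo nK) (sdom cI),
    @iso (dual_data F) (sdom cI) (quo nK) h /\ f = (iota cI \o h) \o pi nK.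
Proof.
rewrite (proof_irrelevance _ nK (normal_Ker f)).
rewrite (proof_irrelevance _ cI (conormal_Im f)).
have [h [[h' [h'h hh']] def_f]] := iso_factor f.
by exists h; split; [exists h'; split | rewrite -compA].
Qed.

(** Kept transparent, so that lemmas instantiated at [dual F] are convertible with their dual
    statements over [F]. *)
Definition dual (F : noetherian_form) : noetherian_form.
Proof.
refine (@NoetherianForm (dual_data F) _ _ _ _ _ _ _ _ _ _ _ _ _ _ _ _ _
  (@quo F) (@pi F) (@piP F) (@pi_bot F)
  (@sdom F) (@iota F) (@iotaP F) (@iota_top F) _ _ _) => /=.
- by move=> W X Y Z f g h; rewrite compA.
- by move=> X Y f; exact: comph1.
- by move=> X Y f; exact: comp1h.
- exact: sle_refl.
- by move=> G A B C leBA leCB; exact: sle_trans leCB leBA.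
- by move=> G A B leBA leAB; exact: sle_anti.
- by move=> X Y f A B; split=> /dimg_pimg.
- exact: pimg_id.
- exact: dimg_id.
- by move=> X Y Z f g A; exact: pimg_comp.
- by move=> X Y Z f g A; exact: dimg_comp.
- by move=> G A B C; exact: sjoin_lub.
- by move=> G A B C; exact: smeet_glb.
- exact: sle_top.
- exact: sbot_le.
- by move=> X Y f B; exact: pimgK.
- by move=> X Y f A; exact: dimgK.
- by move=> X Y f; exact: dual_factor.
- exact: (@conormal_meet F).
- exact: (@normal_join F).
Defined.

(** Duality swaps the two equations of [inverse], so the two sides are equivalent without being
    convertible. *)
Lemma iso_dual (F : noetherian_form) (X Y : Grp F) (f : Hom X Y) :
  @iso (dual F) Y X f <-> iso f.
Proof. by split=> -[g []]; exists g. Qed.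

(** * Dual statements, and comparison of factorizations and pushouts *)

Section DualForms.
Variable F : noetherian_form.
Implicit Types G X Y Z : Grp F.

Lemma pimg_le X Y (f : Hom X Y) (A B : Subgrp Y) :
  sle A B -> sle (pimg f A) (pimg f B).
Proof. exact: (@dimg_le (dual F)). Qed.

Lemma pimg_top X Y (f : Hom X Y) : pimg f (stop Y) = stop X.
Proof. exact: (@dimg_bot (dual F)). Qed.

Lemma pimg_injK X Y (m : Hom X Y) (A : Subgrp X) :
  Ker m = sbot X -> pimg m (dimg m A) = A.
Proof. exact: (@dimg_surjK (dual F)). Qed.

Lemma Ker_comp X Y Z (g : Hom Y Z) (f : Hom X Y) : Ker (g \o f) = pimg f (Ker g).
Proof. exact: (@Im_comp (dual F)). Qed.

Lemma Ker_compr X Y Z (g : Hom Y Z) (f : Hom X Y) :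
  Ker (g \o f) = sbot X -> Ker f = sbot X.
Proof. exact: (@Im_compl (dual F)). Qed.

Lemma Ker_injl X Y Z (g : Hom Y Z) (f : Hom X Y) :
  Ker g = sbot Y -> Ker (g \o f) = Ker f.
Proof. exact: (@Im_surjr (dual F)). Qed.

Lemma iso_inj X Y (f : Hom X Y) : iso f -> Ker f = sbot X.
Proof. by move/iso_dual; exact: (@iso_surj (dual F)). Qed.

Lemma embedding_inj G (S : Subgrp G) M (m : Hom M G) :
  embedding_of S m -> Ker m = sbot M.
Proof. exact: (@projection_surj (dual F)). Qed.

Lemma inj_embedding X Y (m : Hom X Y) :
  Ker m = sbot X -> embedding_of (Im m) m.
Proof. exact: (@surj_projection (dual F)). Qed.

Lemma inj_mono X Y Z (m : Hom Y Z) (u v : Hom X Y) :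
  Ker m = sbot Y -> m \o u = m \o v -> u = v.
Proof. exact: (@surj_epi (dual F)). Qed.

Lemma pullback_exists (B L R : Grp F) (a : Hom L B) (b : Hom R B) :
  Ker a = sbot L -> Ker b = sbot R ->
  exists T (q : Hom T B) (x : Hom T L) (y : Hom T R),
    [/\ embedding_of (smeet (Im a) (Im b)) q, a \o x = q & b \o y = q].
Proof. exact: (@pushout_exists (dual F)). Qed.

Lemma pullback_chase (B L R T : Grp F) (a : Hom L B) (b : Hom R B) (q : Hom T B)
    (x : Hom T L) (y : Hom T R) (S : Subgrp L) :
  Ker a = sbot L -> Ker b = sbot R ->
  embedding_of (smeet (Im a) (Im b)) q -> a \o x = q -> b \o y = q ->
  pimg b (dimg a S) = dimg y (pimg x S).
Proof. exact: (@pushout_chase (dual F)). Qed.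

Lemma smeetC G (A B : Subgrp G) : smeet A B = smeet B A.
Proof. exact: (@sjoinC (dual F)). Qed.

(** The isomorphism [h] of [iso_factor] is absorbed into the embedding. *)
Lemma surj_factor X Y (f : Hom X Y) :
  exists U (e : Hom X U) (m : Hom U Y),
    [/\ projection_of (Ker f) e, embedding_of (Im f) m & f = m \o e].
Proof.
have [h [iso_h def_f]] := iso_factor f.
have proj_e := piP (normal_Ker f).
have inj_m : Ker (iota (conormal_Im f) \o h) = sbot _.
  by rewrite Ker_injl ?(embedding_inj (iotaP _)) //; exact: iso_inj.
move: def_f inj_m; rewrite compA; move: (iota _ \o h) => m def_f inj_m.
have eqIm : Im f = Im m.
  by rewrite {1}def_f Im_surjr //; exact: projection_surj proj_e.
by exists _, (pi (normal_Ker f)), m; split; rewrite ?eqIm //; exact: inj_embedding.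
Qed.

(** The identity lifts through the surjection [f] because the kernel is trivial; the lift is then
    also a right inverse, [f] being epic. *)
Lemma inj_surj_iso X Y (f : Hom X Y) : Ker f = sbot X -> Im f = stop Y -> iso f.
Proof.
move=> inj_f surj_f.
have [v vf] : exists v : Hom Y X, v \o f = idh X.
  by apply: surj_lift => //; rewrite inj_f; exact: sbot_le.
by exists v; split=> //; apply: (surj_epi surj_f); rewrite -compA vf comph1 comp1h.
Qed.

Lemma Ker_dimg X Y Z (e : Hom X Y) (u : Hom Y Z) :
  Im e = stop Y -> Ker (u \o e) = Ker e -> Ker u = sbot Y.
Proof.
move=> surj_e eqK; rewrite -(dimg_surjK (Ker u) surj_e) -Ker_comp eqK.
exact: dimg_surjK.
Qed.

(** The lift [v] of [e' \o u] through [e] is surjective because [e' \o u] is, and injective because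
    both have the same kernel. *)
Lemma surj_iso (A U A' U' : Grp F) (e : Hom A U) (e' : Hom A' U') (u : Hom A A') :
  iso u -> Im e = stop U -> Im e' = stop U' -> Ker (e' \o u) = Ker e ->
  exists2 v : Hom U U', iso v & v \o e = e' \o u.
Proof.
move=> iso_u surj_e surj_e' eqK.
have [v ve] : exists v : Hom U U', v \o e = e' \o u.
  by apply: surj_lift => //; apply: sle_eq.
exists v => //; apply: inj_surj_iso.
  by apply: (Ker_dimg surj_e); rewrite ve.
by apply: (@Im_compl _ _ _ _ v e); rewrite ve Im_surjr //; exact: iso_surj.
Qed.

Lemma factor_iso (A B U A' B' U' : Grp F) (e : Hom A U) (m : Hom U B)
    (e' : Hom A' U') (m' : Hom U' B') (u : Hom A A') (w : Hom B B') :
  iso u -> iso w -> Im e = stop U -> Im e' = stop U' ->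
  Ker m = sbot U -> Ker m' = sbot U' ->
  w \o (m \o e) = (m' \o e') \o u ->
  exists v : Hom U U', [/\ iso v, v \o e = e' \o u & w \o m = m' \o v].
Proof.
move=> iso_u iso_w surj_e surj_e' inj_m inj_m' comm.
have [|v iso_v ve] := surj_iso iso_u surj_e surj_e'.
  rewrite -(Ker_injl _ inj_m') compA -comm Ker_injl; last exact: iso_inj.
  by rewrite Ker_injl.
exists v; split=> //; apply: (surj_epi surj_e).
by rewrite -!compA ve comm compA.
Qed.

Lemma Ker_iso (X X' Y Y' : Grp F) (f : Hom X Y) (f' : Hom X' Y') (u : Hom X X')
    (w : Hom Y Y') :
  iso w -> w \o f = f' \o u -> Ker f = pimg u (Ker f').
Proof. by move=> iso_w eq_f; rewrite -Ker_comp -eq_f Ker_injl //; exact: iso_inj. Qed.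

Lemma pimg_iso_sjoin X Y (u : Hom X Y) (A B : Subgrp Y) :
  iso u -> pimg u (sjoin A B) = sjoin (pimg u A) (pimg u B).
Proof.
move=> iso_u; have inj_u := iso_inj iso_u; have surj_u := iso_surj iso_u.
have /sjoin_lub[leA leB] := sle_refl (sjoin A B).
have /sjoin_lub[leA' leB'] := sle_refl (sjoin (pimg u A) (pimg u B)).
apply: sle_anti; last by apply/sjoin_lub; split; exact: pimg_le.
rewrite -[X in sle _ X](pimg_injK _ inj_u); apply: pimg_le.
apply/sjoin_lub; split; rewrite -[X in sle X _](dimg_surjK _ surj_u);
  exact: dimg_le.
Qed.

(** Preimage along [u] takes the kernels of [a'] and [b'] to those of [a] and [b] and preserves
    joins, so the kernels of [p] and [p'] correspond and [surj_iso] applies. *)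
Lemma pushout_iso (B L R T B' L' R' T' : Grp F) (a : Hom B L)
    (b : Hom B R) (p : Hom B T) (x : Hom L T) (y : Hom R T)
    (a' : Hom B' L') (b' : Hom B' R')
    (p' : Hom B' T') (x' : Hom L' T') (y' : Hom R' T')
    (u : Hom B B') (s : Hom L L') (t : Hom R R') :
  iso u -> iso s -> iso t -> s \o a = a' \o u -> t \o b = b' \o u ->
  Im a = stop L -> Im b = stop R ->
  projection_of (sjoin (Ker a) (Ker b)) p -> x \o a = p -> y \o b = p ->
  projection_of (sjoin (Ker a') (Ker b')) p' -> x' \o a' = p' -> y' \o b' = p' ->
  exists v : Hom T T', [/\ iso v, v \o x = x' \o s & v \o y = y' \o t].
Proof.
move=> iso_u iso_s iso_t sa tb surj_a surj_b proj_p xa yb proj_p' xa' yb'.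
have Kp := projection_normal_Ker (normal_Ker a) (normal_Ker b) proj_p.
have Kp' := projection_normal_Ker (normal_Ker a') (normal_Ker b') proj_p'.
have [|v iso_v vp] := surj_iso iso_u
  (projection_surj proj_p) (projection_surj proj_p').
  rewrite Ker_comp Kp Kp' (Ker_iso iso_s sa) (Ker_iso iso_t tb).
  exact: pimg_iso_sjoin.
exists v; split=> //.
  by apply: (surj_epi surj_a); rewrite -!compA xa sa vp -xa' compA.
by apply: (surj_epi surj_b); rewrite -!compA yb tb vp -yb' compA.
Qed.

End DualForms.

Lemma pullback_iso (F : noetherian_form) (B L R T B' L' R' T' : Grp F)
    (a : Hom L B) (b : Hom R B) (q : Hom T B) (x : Hom T L) (y : Hom T R)
    (a' : Hom L' B') (b' : Hom R' B') (q' : Hom T' B')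
    (x' : Hom T' L') (y' : Hom T' R')
    (u : Hom B B') (s : Hom L L') (t : Hom R R') :
  iso u -> iso s -> iso t -> u \o a = a' \o s -> u \o b = b' \o t ->
  Ker a' = sbot L' -> Ker b' = sbot R' ->
  embedding_of (smeet (Im a) (Im b)) q -> a \o x = q -> b \o y = q ->
  embedding_of (smeet (Im a') (Im b')) q' -> a' \o x' = q' -> b' \o y' = q' ->
  exists v : Hom T T', [/\ iso v, s \o x = x' \o v & t \o y = y' \o v].
Proof.
move=> iso_u iso_s iso_t ua ub inj_a inj_b emb_q ax bx emb_q' ax' bx'.
(* In the dual form [u], [s], [t] and [v] start from the primed diagram, so the two diagrams trade
   places. *)
have [v [/iso_dual iso_v vx vy]] := @pushout_iso (dual F) _ _ _ _ _ _ _ _ _ _ _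
  _ _ _ _ _ _ _ u s t (proj2 (iso_dual _) iso_u) (proj2 (iso_dual _) iso_s)
  (proj2 (iso_dual _) iso_t) (esym ua) (esym ub) inj_a inj_b
  emb_q' ax' bx' emb_q ax bx.
by exists v.
Qed.

(** * Roofs over arrows and wedges *)

Section Arrows.
Variable F : noetherian_form.
Implicit Types A B L R T U X Y Z : Grp F.

Definition climbing X Y (a : arrow X Y) : Prop :=
  match a with Rarr e => Im e = stop Y | Larr m => Ker m = sbot Y end.

Definition descending X Y (a : arrow X Y) : Prop :=
  match a with Rarr m => Ker m = sbot X | Larr e => Im e = stop X end.

(** Mixed directions give [False]: corresponding edges of two pyramids over one base point the same
    way. *)
Definition square X Y X' Y' (a : arrow X Y) (a' : arrow X' Y')
    (u : Hom X X') (w : Hom Y Y') : Prop :=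
  match a, a' with
  | Rarr f, Rarr f' => w \o f = f' \o u
  | Larr f, Larr f' => u \o f = f' \o w
  | _, _ => False
  end.

Lemma square_id X Y (a : arrow X Y) : square a a (idh X) (idh Y).
Proof. by case: a => f /=; rewrite comp1h comph1. Qed.

Lemma square_climbing X Y X' Y' (a : arrow X Y) (a' : arrow X' Y')
    (u : Hom X X') (w1 w2 : Hom Y Y') :
  climbing a -> climbing a' -> square a a' u w1 -> square a a' u w2 -> w1 = w2.
Proof.
case: a => f; case: a' => f' //= ca ca' eq1 eq2.
  by apply: (surj_epi ca); rewrite eq1 eq2.
by apply: (inj_mono ca'); rewrite -eq1 -eq2.
Qed.

Lemma bwd_le X Y (a : arrow X Y) (S T : Subgrp Y) :
  sle S T -> sle (bwd a S) (bwd a T).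
Proof. by case: a => f; [exact: pimg_le | exact: dimg_le]. Qed.

Lemma fwd_le X Y (a : arrow X Y) (S T : Subgrp X) :
  sle S T -> sle (fwd a S) (fwd a T).
Proof. by case: a => f; [exact: dimg_le | exact: pimg_le]. Qed.

(** For a climbing arrow [fwd a] undoes [bwd a]. *)
Lemma climbing_bwd_inj X Y (a : arrow X Y) : climbing a -> injective (bwd a).
Proof.
case: a => f /= ca S T eqST.
  by rewrite -(dimg_surjK S ca) eqST dimg_surjK.
by rewrite -(pimg_injK S ca) eqST pimg_injK.
Qed.

Lemma descending_fwd_inj X Y (a : arrow X Y) : descending a -> injective (fwd a).
Proof.
case: a => f /= da S T eqST.
  by rewrite -(pimg_injK S da) eqST pimg_injK.
by rewrite -(dimg_surjK S da) eqST dimg_surjK.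
Qed.

Lemma descending_bwd_top X Y (a : arrow X Y) :
  descending a -> bwd a (stop Y) = stop X.
Proof. by case: a => f //= _; rewrite pimg_top. Qed.

Lemma factor_roof_exists A B (f : arrow A B) :
  exists U (l : arrow A U) (r : arrow U B), factor_roof f l r.
Proof.
case: f => f; have [U [e [m [proj_e emb_m def_f]]]] := surj_factor f.
  by exists U, (Rarr e), (Rarr m), e, m.
by exists U, (Larr m), (Larr e), e, m.
Qed.

Lemma factor_roof_edges A B U (f : arrow A B) (l : arrow A U) (r : arrow U B) :
  factor_roof f l r -> climbing l /\ descending r.
Proof.
by case: f => f [e [m [/projection_surj ? /embedding_inj ? _ -> ->]]].
Qed.

Lemma factor_roof_fwd A B U (f : arrow A B) (l : arrow A U) (r : arrow U B) S :
  factor_roof f l r -> fwd r (fwd l S) = fwd f S.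
Proof.
by case: f => f [e [m [_ _ -> -> ->]]] /=; rewrite ?dimg_comp ?pimg_comp.
Qed.

Lemma factor_roof_bwd A B U (f : arrow A B) (l : arrow A U) (r : arrow U B) S :
  factor_roof f l r -> bwd l (bwd r S) = bwd f S.
Proof.
by case: f => f [e [m [_ _ -> -> ->]]] /=; rewrite ?dimg_comp ?pimg_comp.
Qed.

Lemma factor_roof_iso A B U A' B' U' (f : arrow A B) (l : arrow A U)
    (r : arrow U B) (f' : arrow A' B') (l' : arrow A' U') (r' : arrow U' B')
    (u : Hom A A') (w : Hom B B') :
  iso u -> iso w -> square f f' u w -> factor_roof f l r ->
  factor_roof f' l' r' ->
  exists v : Hom U U', [/\ iso v, square l l' u v & square r r' v w].
Proof.
move=> iso_u iso_w.
case: f => f; case: f' => f' //= comm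
  [e [m [/projection_surj surj_e /embedding_inj inj_m def_f -> ->]]]
  [e' [m' [/projection_surj surj_e' /embedding_inj inj_m' def_f' -> ->]]] /=;
  rewrite def_f def_f' in comm.
  exact: factor_iso comm.
by have [v []] := factor_iso iso_w iso_u surj_e surj_e' inj_m inj_m' comm;
  exists v.
Qed.

Section WedgeRoof.
Variables (L B R : Grp F) (l : arrow L B) (r : arrow B R).
Hypotheses (desc_l : descending l) (climb_r : climbing r).

Lemma wedge_roof_exists :
  exists T (l' : arrow L T) (r' : arrow T R), wedge_roof l r l' r'.
Proof.
move: l r desc_l climb_r => [a|a] [b|b] /= da cb.
- exact: (factor_roof_exists (Rarr (b \o a))).
- have [T [q [x [y [emb_q ax b_y]]]]] := pullback_exists da cb.
  by exists T, (Larr x), (Rarr y), q, x, y.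
- have [T [p [x [y [proj_p xa yb]]]]] := pushout_exists da cb.
  by exists T, (Rarr x), (Larr y), p, x, y.
- exact: (factor_roof_exists (Larr (a \o b))).
Qed.

Variables (T : Grp F) (l' : arrow L T) (r' : arrow T R).
Hypothesis roof : wedge_roof l r l' r'.

Lemma wedge_roof_edges : climbing l' /\ descending r'.
Proof.
move: l r desc_l climb_r roof => [a|a] [b|b] /= da cb.
- exact: (@factor_roof_edges _ _ _ (Rarr (b \o a))).
- case=> q [x [y [/embedding_inj inj_q ax b_y -> ->]]] /=; split.
    by apply: (@Ker_compr _ _ _ _ a); rewrite ax.
  by apply: (@Ker_compr _ _ _ _ b); rewrite b_y.
- case=> p [x [y [/projection_surj surj_p xa yb -> ->]]] /=; split.
    by apply: (@Im_compl _ _ _ _ x a); rewrite xa.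
  by apply: (@Im_compl _ _ _ _ y b); rewrite yb.
- exact: (@factor_roof_edges _ _ _ (Larr (a \o b))).
Qed.

Lemma wedge_roof_fwd S : fwd r' (fwd l' S) = fwd r (fwd l S).
Proof.
move: l r desc_l climb_r roof => [a|a] [b|b] /= da cb.
- by move/(@factor_roof_fwd _ _ _ (Rarr (b \o a)))->; rewrite /= dimg_comp.
- case=> q [x [y [emb_q ax b_y -> ->]]] /=.
  by rewrite (pullback_chase S da cb emb_q ax b_y).
- case=> p [x [y [proj_p xa yb -> ->]]] /=.
  by rewrite (pushout_chase S da cb proj_p xa yb).
- by move/(@factor_roof_fwd _ _ _ (Larr (a \o b)))->; rewrite /= pimg_comp.
Qed.

Lemma wedge_roof_bwd S : bwd l' (bwd r' S) = bwd l (bwd r S).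
Proof.
move: l r desc_l climb_r roof => [a|a] [b|b] /= da cb.
- by move/(@factor_roof_bwd _ _ _ (Rarr (b \o a)))->; rewrite /= pimg_comp.
(* Backward chasing exchanges the legs of the wedge, so the meet here and the join below are
   commuted first. *)
- case=> q [x [y [emb_q ax b_y -> ->]]] /=; rewrite smeetC in emb_q.
  by rewrite (pullback_chase S cb da emb_q b_y ax).
- case=> p [x [y [proj_p xa yb -> ->]]] /=; rewrite sjoinC in proj_p.
  by rewrite (pushout_chase S cb da proj_p yb xa).
- by move/(@factor_roof_bwd _ _ _ (Larr (a \o b)))->; rewrite /= dimg_comp.
Qed.

End WedgeRoof.

Lemma wedge_roof_iso L B R T L' B' R' T' (l : arrow L B) (r : arrow B R)
    (lT : arrow L T) (rT : arrow T R) (l' : arrow L' B') (r' : arrow B' R')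
    (lT' : arrow L' T') (rT' : arrow T' R')
    (s : Hom L L') (u : Hom B B') (t : Hom R R') :
  descending l -> climbing r -> descending l' -> climbing r' ->
  iso s -> iso u -> iso t -> square l l' s u -> square r r' u t ->
  wedge_roof l r lT rT -> wedge_roof l' r' lT' rT' ->
  exists v : Hom T T', [/\ iso v, square lT lT' s v & square rT rT' v t].
Proof.
move=> + + + + iso_s iso_u iso_t.
(* The squares exclude mixed directions, leaving the four shapes of a wedge. *)
case: l l' r r' => a [] a' // [] b [] b' // da cb da' cb' sq_l sq_r.
- apply: factor_roof_iso => //=.
  by rewrite compA sq_r -compA sq_l compA.
- case=> q [x [y [emb_q ax b_y -> ->]]] [q' [x' [y' [emb_q' ax' b_y' -> ->]]]].
  exact: (pullback_iso iso_u iso_s iso_t sq_l sq_r da' cb' emb_q ax b_y emb_q').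
- case=> p [x [y [proj_p xa yb -> ->]]] [p' [x' [y' [proj_p' xa' yb' -> ->]]]].
  exact: (pushout_iso iso_u iso_s iso_t sq_l sq_r da cb proj_p xa yb proj_p').
- apply: factor_roof_iso => //=.
  by rewrite compA sq_l -compA sq_r compA.
Qed.

End Arrows.

(** * Chasing and composites along collapsible zigzags *)

Section Zigzags.
Variable F : noetherian_form.
Implicit Types X Y Z : Grp F.

Lemma chase_back_le X Y (z : zigzag X Y) (S T : Subgrp Y) :
  sle S T -> sle (chase_back z S) (chase_back z T).
Proof. by elim: z S T => //= Y' Z z IHz a S T leST; apply/IHz/bwd_le. Qed.

Lemma inverse_pimg X Y (f : Hom X Y) (g : Hom Y X) (S : Subgrp Y) :
  inverse f g -> pimg f S = dimg g S.
Proof.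
move=> [gf fg]; have inj_f : Ker f = sbot X by apply: iso_inj; exists g.
by rewrite -{1}[S]dimg_id -fg -dimg_comp pimg_injK.
Qed.

Lemma inverse_dimg X Y (f : Hom X Y) (g : Hom Y X) (S : Subgrp X) :
  inverse f g -> dimg f S = pimg g S.
Proof. by case=> gf fg; rewrite (@inverse_pimg _ _ g f). Qed.

Lemma composite_exists X Y (z : zigzag X Y) :
  collapsible z -> exists h, composite z h.
Proof.
elim: z => [|Y' Z z IHz [f|f]] /=; first by exists (idh X).
  by case=> /IHz[k comp_k] _; exists (f \o k), k.
by case=> /IHz[k comp_k] [g inv_fg]; exists (g \o k), k => //; exists g.
Qed.

Lemma composite_chase X Y (z : zigzag X Y) h :
  composite z h ->
  (forall S, dimg h S = chase z S) /\ (forall S, pimg h S = chase_back z S).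
Proof.
elim: z h => [|Y' Z z IHz a] h /=;
  first by move=> ->; split=> S; rewrite ?dimg_id ?pimg_id.
case=> k /IHz[chase_k back_k]; case: a => f; first move=> ->.
  by split=> S; rewrite -?dimg_comp -?pimg_comp ?chase_k ?back_k.
case=> g inv_fg ->; split=> S.
  by rewrite -dimg_comp chase_k /= (inverse_pimg _ inv_fg).
by rewrite -pimg_comp back_k /= (inverse_dimg _ inv_fg).
Qed.

(** The induction step for comparing two pyramids: agreement of composites up to [u] propagates
    across one edge. For left-pointing arrows the square is inverted first. *)
Lemma composite_square X Y Z Y' Z' (z : zigzag X Y) (z' : zigzag X Y')
    (a : arrow Y Z) (a' : arrow Y' Z') (u : Hom Y Y') (w : Hom Z Z') :
  square a a' u w ->
  (forall k k', composite z k -> composite z' k' -> k' = u \o k) ->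
  forall h h', composite (zz_snoc z a) h -> composite (zz_snoc z' a') h' ->
  h' = w \o h.
Proof.
move=> + comp_u h h' [k comp_k +] [k' /(comp_u _ _ comp_k)->].
case: a a' => f [] f' //= sq.
  by move=> -> ->; rewrite !compA sq.
case=> g [gf fg] -> [g' [g'f' f'g'] ->].
by rewrite -(comp1h w) -g'f' -(compA g') -sq !compA
  -[g' \o u \o f \o g]compA fg comph1.
Qed.

End Zigzags.

(** * Pyramids *)

Section PyramidExistence.
Variables (F : noetherian_form) (n : nat).

(* The edges between the nodes of heights [d] and [d.+1]; fixing the lower nodes
   [lo] in the type makes consecutive rows share nodes definitionally. *)
Record row (d : nat) (lo : nat -> Grp F) := Row {
  hi : nat -> Grp F;
  row_climb : forall i, i + d < n -> arrow (lo i) (hi i);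
  row_descend : forall i, i + d < n -> arrow (hi i) (lo i.+1);
  row_climbing : forall i (h : i + d < n), climbing (row_climb h);
  row_descending : forall i (h : i + d < n), descending (row_descend h)
}.

Lemma choose_row d (lo : nat -> Grp F)
    (P : forall i T, arrow (lo i) T -> arrow T (lo i.+1) -> Prop) :
  (forall i, i + d < n -> exists T (l : arrow (lo i) T) (r : arrow T (lo i.+1)),
     [/\ climbing l, descending r & P i T l r]) ->
  exists R : row d lo, forall i (h : i + d < n),
    P i (hi R i) (row_climb R h) (row_descend R h).
Proof.
move=> exP.
(* The edges are functions of the bound proof, so that a node can be chosen for every [i] at
   once. *)
have ex i : exists t : {T : Grp F &
    ((i + d < n -> arrow (lo i) T) * (i + d < n -> arrow T (lo i.+1)))%type},
    forall h : i + d < n, let: existT T (l, r) := t in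
    [/\ climbing (l h), descending (r h) & P i T (l h) (r h)].
  case lt_i: (i + d < n).
    have [T [l [r lrP]]] := exP i lt_i.
    by exists (existT _ T (fun=> l, fun=> r)).
  (* Outside the row the bound is false: [lo i] is a default node and the edges are vacuous
     functions. *)
  have no (A : Type) : false -> A by [].
  by exists (existT _ (lo i) (@no _, @no _)).
pose c i := proj1_sig (constructive_indefinite_description _ (ex i)).
pose l i (h : i + d < n) : arrow (lo i) (projT1 (c i)) := (projT2 (c i)).1 h.
pose r i (h : i + d < n) : arrow (projT1 (c i)) (lo i.+1) := (projT2 (c i)).2 h.
have lrP i (h : i + d < n) :
    [/\ climbing (l i h), descending (r i h) & P i _ (l i h) (r i h)].
  by rewrite /l /r /c; case: constructive_indefinite_description => -[T []] /=.
have cl i h : climbing (l i h) by case: (lrP i h).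
have de i h : descending (r i h) by case: (lrP i h).
by exists (Row cl de) => i h; case: (lrP i h).
Qed.

Variables (X : nat -> Grp F) (f : forall i, i < n -> arrow (X i) (X i.+1)).

Lemma base_row : exists R : row 0 X, forall i (h : i + 0 < n) (h0 : i < n),
  factor_roof (f h0) (row_climb R h) (row_descend R h).
Proof.
(* The property passed to [choose_row] cannot mention its bound proof, so it quantifies over the
   proof that [f] takes. *)
have [|R RP] := @choose_row 0 X
  (fun i T l r => forall h0 : i < n, factor_roof (f h0) l r).
  move=> i h; have h0 : i < n by rewrite -(addn0 i).
  have [T [l [r roof]]] := factor_roof_exists (f h0).
  have [cl de] := factor_roof_edges roof.
  by exists T, l, r; split=> // h1; rewrite (bool_irrelevance h1 h0).
by exists R => i h; exact: RP.
Qed.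

Lemma next_row d (lo : nat -> Grp F) (R : row d lo) :
  exists R' : row d.+1 (hi R),
    forall i (h : i + d.+1 < n) (h1 : i + d < n) (h2 : i.+1 + d < n),
    wedge_roof (row_descend R h1) (row_climb R h2)
      (row_climb R' h) (row_descend R' h).
Proof.
have [|R' RP] := @choose_row d.+1 (hi R) (fun i T l r =>
    forall (h1 : i + d < n) (h2 : i.+1 + d < n),
    wedge_roof (row_descend R h1) (row_climb R h2) l r).
  move=> i h; have h2 : i.+1 + d < n by rewrite addSnnS.
  have h1 : i + d < n by exact: ltn_trans h2.
  have [T [l [r roof]]] :=
    wedge_roof_exists (row_descending R h1) (row_climbing R h2).
  have [cl de] :=
    wedge_roof_edges (row_descending R h1) (row_climbing R h2) roof.
  exists T, l, r; split=> // h1' h2'.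
  by rewrite (bool_irrelevance h1' h1) (bool_irrelevance h2' h2).
by exists R' => i h; exact: RP.
Qed.

Let next d lo (R : row d lo) :=
  constructive_indefinite_description _ (next_row R).

Fixpoint rows (R0 : row 0 X) (d : nat) : {lo : nat -> Grp F & row d lo} :=
  match d with
  | 0 => existT _ X R0
  | d'.+1 => existT _ (hi (projT2 (rows R0 d')))
                      (proj1_sig (next (projT2 (rows R0 d'))))
  end.

Lemma pyramid_exists : inhabited (pyramid f).
Proof.
have [R0 base] := base_row.
pose up i d := hi (projT2 (rows R0 d)) i.
(* The case split on [d] only serves to make [pnode] reduce. *)
pose climb_up i d : i + d < n -> arrow (pnode X up i d) (pnode X up i d.+1) :=
  match d with
  | 0 => fun h => row_climb (projT2 (rows R0 0)) h
  | d'.+1 => fun h => row_climb (projT2 (rows R0 d'.+1)) h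
  end.
pose descend_up i d :
    i + d < n -> arrow (pnode X up i d.+1) (pnode X up i.+1 d) :=
  match d with
  | 0 => fun h => row_descend (projT2 (rows R0 0)) h
  | d'.+1 => fun h => row_descend (projT2 (rows R0 d'.+1)) h
  end.
split; apply: (@Pyramid _ _ _ f up climb_up descend_up).
  by move=> i h h0; exact: base.
move=> i [|d] h1 h2 h.
  exact: (proj2_sig (next (projT2 (rows R0 0)))).
exact: (proj2_sig (next (projT2 (rows R0 d.+1)))).
Qed.

End PyramidExistence.

(** * Chasing along the sides of a pyramid, and collapsibility *)

Section PyramidChase.
Variables (F : noetherian_form) (n : nat) (X : nat -> Grp F).
Variables (f : forall i, i < n -> arrow (X i) (X i.+1)) (P : pyramid f).

Lemma pyramid_edges d i (h : i + d < n) :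
  climbing (climb P h) /\ descending (descend P h).
Proof.
elim: d i h => [|d IHd] i h.
  have h0 : i < n by rewrite -(addn0 i).
  exact: factor_roof_edges (pyramid_base P h0 h).
have h2 : i.+1 + d < n by rewrite addSnnS.
have h1 : i + d < n by exact: ltn_trans h2.
have [_ de] := IHd i h1; have [cl _] := IHd _ h2.
exact: (wedge_roof_edges de cl (pyramid_step P h1 h2 h)).
Qed.

Lemma climb_climbing d i (h : i + d < n) : climbing (climb P h).
Proof. by case: (pyramid_edges h). Qed.

Lemma descend_descending d i (h : i + d < n) : descending (descend P h).
Proof. by case: (pyramid_edges h). Qed.

Lemma track_base i d : i + d <= n -> i <= n.
Proof. exact: leq_trans (leq_addr d i). Qed.

Lemma track_prev i d : i + d.+1 <= n -> i + d < n.
Proof. by rewrite addnS. Qed.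

(** The base up to [X i], then [d] climbing edges. These paths interpolate between the left side
    ([i = 0]) and the base ([i = n], [d = 0]). *)
Fixpoint track i d : i + d <= n -> zigzag (X 0) (pnode X (up P) i d) :=
  match d with
  | 0 => fun h => prefix f (track_base h)
  | d'.+1 => fun h =>
      zz_snoc (track (ltnW (track_prev h))) (climb P (track_prev h))
  end.

Definition same_chase Y (z z' : zigzag (X 0) Y) : Prop :=
  (forall S, chase z S = chase z' S) /\
  (forall S, chase_back z S = chase_back z' S).

Lemma track_descend d i (h : i + d.+1 <= n) (h1 : i + d < n)
    (h2 : i.+1 + d <= n) :
  same_chase (zz_snoc (track h) (descend P h1)) (track h2).
Proof.
elim: d i h h1 h2 => [|d IHd] i h h1 h2 /=.
  have h0 : i < n by rewrite -(addn0 i).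
  rewrite (bool_irrelevance (track_prev h) h1).
  rewrite (bool_irrelevance (track_base h2) h0).
  rewrite (bool_irrelevance (track_base (ltnW h1)) (ltnW h0)).
  have roof := pyramid_base P h0 h1.
  by split=> S /=; rewrite ?(factor_roof_fwd _ roof) ?(factor_roof_bwd _ roof).
rewrite (bool_irrelevance (track_prev h) h1).
(* The last two edges form a roof; it is replaced by the wedge below it, whose descending edge falls
   under the induction hypothesis. *)
set h3 := track_prev h2.
have h5 : i + d < n by exact: ltn_trans h3.
have [/= IHf IHb] := IHd i (ltnW h1) h5 (ltnW h3).
have roof := pyramid_step P h5 h3 h1.
have de := descend_descending h5; have cl := climb_climbing h3.
split=> S /=.
  by rewrite (wedge_roof_fwd de cl roof) IHf.
by rewrite (wedge_roof_bwd de cl roof) IHb.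
Qed.

Lemma left_side_track d (h : d <= n) (h0 : 0 + d <= n) :
  same_chase (left_side P h) (track h0).
Proof.
elim: d h h0 => [|d IHd] h h0 //=.
have [IHf IHb] := IHd (ltnW h) (ltnW h).
rewrite (bool_irrelevance (track_prev h0) h).
by split=> S /=; rewrite ?IHf ?IHb.
Qed.

Lemma sides_track i d (e : i + d = n) (h : i + d <= n) :
  same_chase (sides P e) (track h).
Proof.
elim: i d e h => [|i IHi] d e h; first exact: left_side_track.
have h1 : i + d.+1 <= n by rewrite -addSnnS.
have [IHf IHb] := IHi _ (side_prev e) h1.
have [tf tb] := track_descend h1 (side_lt e) h.
by split=> S; rewrite -?tf -?tb /= ?IHf ?IHb.
Qed.

Lemma principal_chase : same_chase (principal P) (zigzag_of f).
Proof.
have h : n + 0 <= n by rewrite addn0.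
have [cf cb] := sides_track (addn0 n) h.
by split=> S; rewrite ?cf ?cb /= (bool_irrelevance (track_base h) (leqnn n)).
Qed.

Lemma left_side_inj d (h : d <= n) : injective (chase_back (left_side P h)).
Proof.
elim: d h => [|d IHd] h S T //= /IHd.
by apply: climbing_bwd_inj; exact: climb_climbing.
Qed.

Lemma left_side_collapsible d (h : d <= n) :
  chase_back (left_side P h) (stop _) = stop _ -> collapsible (left_side P h).
Proof.
elim: d h => [|d IHd] h //= eq_top.
have back_top : chase_back (left_side P (ltnW h)) (stop _) = stop _.
  by apply: stop_eq; rewrite -eq_top; apply: chase_back_le; exact: sle_top.
split; first exact: IHd.
(* Chasing back from the lower node, the largest subgroup and its [bwd] image along the last edge
   give the same result, so injectivity identifies them. *)
have /left_side_inj := etrans eq_top (esym back_top).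
have := climb_climbing (h : 0 + d < n).
by case: (climb P _) => m //= inj_m surj_m; exact: inj_surj_iso.
Qed.

Lemma sides_collapsible i d (e : i + d = n) :
  chase_back (sides P e) (stop _) = stop _ ->
  chase (sides P e) (sbot _) = sbot _ -> collapsible (sides P e).
Proof.
elim: i d e => [|i IHi] d e /=; first by move=> + _; exact: left_side_collapsible.
have de := descend_descending (side_lt e).
rewrite (descending_bwd_top de) => back_top eq_bot.
(* For an upward edge, read leftwards here, this says that its kernel is trivial. *)
have fwd_bot : fwd (descend P (side_lt e)) (sbot _) = sbot _.
  by apply: sbot_eq; rewrite -eq_bot; apply: fwd_le; exact: sbot_le.
have chase_bot : chase (sides P (side_prev e)) (sbot _) = sbot _.
  by apply: (descending_fwd_inj de); rewrite eq_bot fwd_bot.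
split; first exact: IHi.
case: (descend P _) de fwd_bot => m //= surj_m inj_m; exact: inj_surj_iso.
Qed.

Lemma principal_collapsible :
  chase (zigzag_of f) (sbot (X 0)) = sbot (X n) ->
  chase_back (zigzag_of f) (stop (X n)) = stop (X 0) ->
  collapsible (principal P).
Proof.
have [cf cb] := principal_chase; rewrite -cf -cb => chase_bot back_top.
exact: sides_collapsible.
Qed.

End PyramidChase.

(** * Comparison of two pyramids over the same base *)

Section PyramidUniqueness.
Variables (F : noetherian_form) (n : nat) (X : nat -> Grp F).
Variables (f : forall i, i < n -> arrow (X i) (X i.+1)) (P Q : pyramid f).

(* At most one homomorphism matches at each node, since climbing edges are epic or
   monic; hence the comparisons chosen at two adjacent nodes agree below them. *)
Fixpoint node_match d i : Hom (pnode X (up P) i d) (pnode X (up Q) i d) -> Prop :=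
  match d with
  | 0 => fun v => v = idh (X i)
  | d'.+1 => fun v => exists (h : i + d' < n) u w,
      [/\ iso v, @node_match d' i u, @node_match d' i.+1 w,
          square (climb P h) (climb Q h) u v
        & square (descend P h) (descend Q h) v w]
  end.

Lemma node_match_iso d i (v : Hom (pnode X (up P) i d) (pnode X (up Q) i d)) :
  node_match v -> iso v.
Proof.
case: d v => [|d] v /=; last by case=> h [u [w []]].
by move=> ->; exists (idh (X i)); split; exact: comp1h.
Qed.

Lemma node_match_uniq d i (v1 v2 : Hom (pnode X (up P) i d) (pnode X (up Q) i d)) :
  node_match v1 -> node_match v2 -> v1 = v2.
Proof.
elim: d i v1 v2 => [|d IHd] i v1 v2 /=; first by move=> -> ->.
case=> h [u1 [w1 [_ match_u1 _ sq1 _]]] [h' [u2 [w2 [_ match_u2 _ sq2 _]]]].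
rewrite (bool_irrelevance h' h) (IHd _ _ _ match_u2 match_u1) in sq2.
exact: square_climbing (climb_climbing P h) (climb_climbing Q h) sq1 sq2.
Qed.

Lemma node_match_exists d i : i + d <= n ->
  exists v : Hom (pnode X (up P) i d) (pnode X (up Q) i d), node_match v.
Proof.
elim: d i => [|d IHd] i h; first by exists (idh (X i)).
rewrite addnS in h.
have [u match_u] := IHd i (ltnW h).
have [|w match_w] := IHd i.+1; first by rewrite addSn.
have iso_u := node_match_iso match_u; have iso_w := node_match_iso match_w.
suff [v [iso_v sq1 sq2]] : exists v, [/\ iso v,
    square (climb P h) (climb Q h) u v & square (descend P h) (descend Q h) v w].
  by exists v, h, u, w.
(* At height one the node is the roof of a base arrow; higher up it is the roof of a wedge. *)
case: d h u w iso_u match_u iso_w match_w {IHd} => [|d] h u w.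
  move=> iso_u /= def_u iso_w def_w; have h0 : i < n by rewrite -(addn0 i).
  apply: (factor_roof_iso iso_u iso_w _ (pyramid_base P h0 h) (pyramid_base Q h0 h)).
  by rewrite def_u def_w; exact: square_id.
move=> iso_u [h1 [_ [t [_ _ match_t _ sq_l]]]].
move=> iso_w [h2 [t' [_ [_ match_t' _ sq_r _]]]].
(* [t] and [t'] both compare the bottom node of the wedge, reached from the left and from the
   right. *)
rewrite (node_match_uniq match_t' match_t) in sq_r.
exact: (wedge_roof_iso (descend_descending P h1) (climb_climbing P h2)
  (descend_descending Q h1) (climb_climbing Q h2) iso_u (node_match_iso match_t)
  iso_w sq_l sq_r (pyramid_step P h1 h2 h) (pyramid_step Q h1 h2 h)).
Qed.

Lemma left_side_composite d (h : d <= n)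
    (v : Hom (pnode X (up P) 0 d) (pnode X (up Q) 0 d)) k k' :
  node_match v -> composite (left_side P h) k -> composite (left_side Q h) k' ->
  k' = v \o k.
Proof.
elim: d h v k k' => [|d IHd] h v k k'; first by move=> /= -> -> ->; rewrite comp1h.
case=> h' [u [w [_ match_u _ sq _]]]; rewrite (bool_irrelevance h' h) in sq.
apply: (composite_square sq) => k1 k1'; exact: IHd.
Qed.

Lemma sides_composite i d (e : i + d = n)
    (v : Hom (pnode X (up P) i d) (pnode X (up Q) i d)) k k' :
  node_match v -> composite (sides P e) k -> composite (sides Q e) k' ->
  k' = v \o k.
Proof.
elim: i d e v k k' => [|i IHi] d e v k k' match_v.
  exact: left_side_composite.
(* The square for the last edge belongs to the match at its upper node; uniqueness identifies its
   lower comparison with [v]. *)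
have [|t match_t] := @node_match_exists d.+1 i; first by rewrite (side_prev e).
have [h [u [w [_ _ match_w _ sq]]]] := match_t.
rewrite (bool_irrelevance h (side_lt e)) (node_match_uniq match_w match_v) in sq.
apply: (composite_square sq) => k1 k1'; exact: IHi.
Qed.

Lemma principal_composite h h' :
  composite (principal P) h -> composite (principal Q) h' -> h' = h.
Proof.
rewrite -[RHS]comp1h => comp_h comp_h'.
exact: (@sides_composite n 0 (addn0 n) (idh (X n)) h h' erefl comp_h comp_h').
Qed.

End PyramidUniqueness.

Unset Implicit Arguments.

Theorem theorem3p3 (F : noetherian_form) (n : nat) (n_ge1 : 1 <= n)
    (X : nat -> Grp F) (f : forall i, i < n -> arrow (X i) (X i.+1)) :
  (induces f <->
     chase (zigzag_of f) (sbot (X 0)) = sbot (X n) /\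
     chase_back (zigzag_of f) (stop (X n)) = stop (X 0)) /\
  (induces f ->
     exists h : Hom (X 0) (X n),
       [/\ forall P : pyramid f, induced_by P h,
           forall (P : pyramid f) (h' : Hom (X 0) (X n)),
             induced_by P h' -> h' = h,
           forall S : Subgrp (X 0), dimg h S = chase (zigzag_of f) S
         & forall T : Subgrp (X n),
             pimg h T = chase_back (zigzag_of f) T]).
Proof.
have chase_induced (P : pyramid f) h : composite (principal P) h ->
    (forall S, dimg h S = chase (zigzag_of f) S) /\
    (forall T, pimg h T = chase_back (zigzag_of f) T).
  case/composite_chase=> cf cb; have [pf pb] := principal_chase P.
  by split=> S; rewrite ?cf ?cb.
have chase_ends : induces f ->
    chase (zigzag_of f) (sbot (X 0)) = sbot (X n) /\
    chase_back (zigzag_of f) (stop (X n)) = stop (X 0).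
  case=> P /composite_exists[h /chase_induced[cf cb]].
  (* Necessity: direct images preserve the trivial subgroup and inverse images the largest one. *)
  by rewrite -cf -cb dimg_bot pimg_top.
split; first split=> // -[chase_bot back_top].
  by have [P] := pyramid_exists f; exists P; exact: principal_collapsible.
move=> ind; have [chase_bot back_top] := chase_ends ind.
case: ind => P0 /composite_exists[h comp_h]; exists h.
have [cf cb] := chase_induced P0 h comp_h.
split=> // [P|P h' [_ comp_h']]; last exact: principal_composite comp_h comp_h'.
(* The chasing conditions concern only the base, so they make the sides of every pyramid
   collapsible, not only those of [P0]. *)
have coll_P : collapsible (principal P) by exact: principal_collapsible.
split=> //; have [h' comp_h'] := composite_exists coll_P.
by rewrite -(principal_composite comp_h comp_h').
Qed.
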